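(* Let $A \in \mathbb{R}^{n \times n}$, $b, c \in \mathbb{R}^n$ with $c_1 = 0$, $\mu \in \mathbb{R}$, and consider the impacting hybrid system $$\begin{aligned} \dot{x} &= A x + b \mu, && \text{for } x_1 < 0, \\ x &\mapsto x + v(x;\mu)\, c, && \text{whenever } x_1 = 0, \end{aligned}$$ where $x = (x_1,\ldots,x_n) \in \mathbb{R}^n$ and $v(x;\mu) = e_1^{\sf T}(A x + b \mu)$. Let $q^{\sf T} = e_1^{\sf T} \, {\rm adj}(A)$ be the first row of the adjugate of $A$. Let $x^L(\mu) = -A^{-1} b \mu$ be the regular equilibrium (when $\det(A) \ne 0$), and let $x^{St}(\mu)$ be the pseudo-equilibrium of the system (unique when $\det(A) \neq 0$, $e_1^{\sf T} A c < -1$ and $q^{\sf T} c \ne 0$). If $\det(A) \ne 0$, $e_1^{\sf T} A c < -1$, $q^{\sf T} c \ne 0$, and $x^L(\mu)$ and $x^{St}(\mu)$ are virtual, then every solution to the system diverges as $t \to \infty$.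
   Context: $e_1$ is the first standard basis vector of $\mathbb{R}^n$, $I$ is the $n\times n$ identity matrix, and a subscript $1$ on a vector denotes its first component. ${\rm adj}(A)$ is the adjugate matrix: ${\rm adj}(A)_{ij} = (-1)^{i+j} m_{ji}$, where $m_{ji}$ is the determinant of the matrix obtained by removing row $j$ and column $i$ from $A$. Write $f(x;\mu) = Ax + b\mu$ and $\Sigma = \{ x \in \mathbb{R}^n \mid x_1 = 0 \}$. The set $\Sigma$ is partitioned into the incoming set $\Sigma_{\rm in} = \{ x \in \Sigma \mid v(x;\mu) > 0 \}$, the outgoing set $\Sigma_{\rm out} = \{ x \in \Sigma \mid v(x;\mu) < 0 \}$, and the grazing set $\Gamma = \{ x \in \Sigma \mid v(x;\mu) = 0 \}$. The condition $e_1^{\sf T} A c < -1$ ensures that the reset law $x \mapsto x + v(x;\mu)c$ maps $\Sigma_{\rm in}$ into $\Sigma_{\rm out}$; it is the identity on $\Gamma$. The reset law is applied when a solution arrives at $\Sigma_{\rm in}$ (it models an impact). Let $a(x;\mu) = e_1^{\sf T} A (A x + b \mu)$. A subset $S \subset \Gamma$ is a sticking region if $a(x;\mu) > 0$ for all $x \in S$, and a detaching region if $a(x;\mu) < 0$ for all $x \in S$. The sticking vector field, for $x \in \Gamma$, is $$f^{St}(x;\mu) = \left( I - \frac{c\, e_1^{\sf T} A}{e_1^{\sf T} A c} \right) f(x;\mu).$$ Solutions are concatenations of smooth segments of motion in $x_1 < 0$ under $f$, instantaneous jumps defined by the reset law, and smooth segments of motion on sticking regions under $f^{St}$; they are considered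 for all $t \ge 0$. A solution $\phi(t)$ diverges as $t\to\infty$ if $\|\phi(t)\| \to \infty$ as $t \to \infty$, where $\|\cdot\|$ is the Euclidean norm. The regular equilibrium $x^L(\mu)$ is virtual if $x^L_1(\mu) > 0$ (and admissible if $x^L_1(\mu) < 0$). A point $x \in \Gamma$ is a pseudo-equilibrium if $f^{St}(x;\mu) = 0$; it is virtual if it belongs to a detaching region (and admissible if it belongs to a sticking region). *)

(* Defs.v *)
From mathcomp Require Import all_boot all_order all_algebra.
From mathcomp Require Import all_classical all_reals all_analysis.
Set Implicit Arguments.
Unset Strict Implicit.
Unset Printing Implicit Defensive.

Import Order.TTheory GRing.Theory Num.Theory.
Import numFieldNormedType.Exports.

Local Open Scope classical_set_scope.
Local Open Scope ring_scope.

(* The dimension of the phase space is written n.+1 so that the first component,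
   of index ord0, exists. *)

Definition e1 (R : realType) (n : nat) : 'cV[R]_n.+1 := delta_mx ord0 ord0.

Definition comp1 (R : realType) (n : nat) (x : 'cV[R]_n.+1) : R := x ord0 ord0.

(* The norm that the library puts on matrices is the maximum norm. *)
Definition euclidean_norm (R : realType) (n : nat) (x : 'cV[R]_n) : R :=
  Num.sqrt (\sum_(i < n) x i ord0 ^+ 2).

Definition scal (R : realType) (M : 'M[R]_1) : R := M ord0 ord0.

Definition e1Ac (R : realType) (n : nat) (A : 'M[R]_n.+1) (c : 'cV[R]_n.+1) : R :=
  scal ((e1 R n)^T *m A *m c).

Definition qT (R : realType) (n : nat) (A : 'M[R]_n.+1) : 'rV[R]_n.+1 :=
  (e1 R n)^T *m \adj A.

Section ImpactingHybridSystem.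
Variables (R : realType) (n : nat).
Variables (A : 'M[R]_n.+1) (b c : 'cV[R]_n.+1) (mu : R).

Definition vfield (x : 'cV[R]_n.+1) : 'cV[R]_n.+1 := A *m x + mu *: b.

Definition velocity (x : 'cV[R]_n.+1) : R := scal ((e1 R n)^T *m vfield x).

Definition acceleration (x : 'cV[R]_n.+1) : R :=
  scal ((e1 R n)^T *m A *m vfield x).

Definition Sigma : set 'cV[R]_n.+1 := [set x | comp1 x = 0].

Definition Sigma_in : set 'cV[R]_n.+1 := [set x | Sigma x /\ 0 < velocity x].

Definition Gamma : set 'cV[R]_n.+1 := [set x | Sigma x /\ velocity x = 0].

Definition reset (x : 'cV[R]_n.+1) : 'cV[R]_n.+1 := x + velocity x *: c.

Definition sticking_region (S : set 'cV[R]_n.+1) : Prop :=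
  S `<=` Gamma /\ forall x, S x -> 0 < acceleration x.

Definition detaching_region (S : set 'cV[R]_n.+1) : Prop :=
  S `<=` Gamma /\ forall x, S x -> acceleration x < 0.

Definition sticking_vfield (x : 'cV[R]_n.+1) : 'cV[R]_n.+1 :=
  (1%:M - (e1Ac A c)^-1 *: (c *m (e1 R n)^T *m A)) *m vfield x.

(* Meaningful only when \det A != 0, since invmx A = A otherwise. *)
Definition regular_equilibrium : 'cV[R]_n.+1 := - (invmx A *m (mu *: b)).

Definition regular_equilibrium_virtual : Prop := 0 < comp1 regular_equilibrium.

Definition pseudo_equilibrium (x : 'cV[R]_n.+1) : Prop :=
  Gamma x /\ sticking_vfield x = 0.

Definition pseudo_equilibrium_virtual (x : 'cV[R]_n.+1) : Prop :=
  exists S, detaching_region S /\ S x.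

(* The state z that follows the arrival at the state y: the reset law acts on
   the incoming set only (it is the identity on Gamma, and Sigma_out is never
   reached by motion in x_1 < 0). *)
Definition arrival (y z : 'cV[R]_n.+1) : Prop :=
  (Sigma_in y -> z = reset y) /\ (~ Sigma_in y -> z = y).

Definition regular_motion_at (phi : R -> 'cV[R]_n.+1) (t : R) : Prop :=
  \forall s \near t, comp1 (phi s) < 0 /\ is_derive s 1 phi (vfield (phi s)).

Definition sticking_motion_at (phi : R -> 'cV[R]_n.+1) (t : R) : Prop :=
  exists S, sticking_region S /\
    \forall s \near t, S (phi s) /\
      is_derive s 1 phi (sticking_vfield (phi s)).

(* A solution on [0, +oo[ started at x0; values at negative times are
   irrelevant. phi is its right-continuous representative: phi t is the state
   after a possible impact at time t, and the left limit at t is the state that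
   arrives. The countable set E consists of the times at which segments are
   joined: impacts, grazings, beginnings and ends of sticking, and accumulation
   points of these. No discreteness of E is assumed, so that a solution may
   undergo infinitely many impacts in finite time (chattering) and continue
   from the limit point. *)
Definition is_solution (x0 : 'cV[R]_n.+1) (phi : R -> 'cV[R]_n.+1) : Prop :=
  [/\ arrival x0 (phi 0),
      (forall t : R, 0 <= t -> phi s @[s --> t^'+] --> phi t),
      (forall t : R, 0 < t ->
         exists y : 'cV[R]_n.+1, phi s @[s --> t^'-] --> y /\ arrival y (phi t))
    & exists E : set R, countable E /\
        forall t : R, 0 < t -> ~ E t ->
          regular_motion_at phi t \/ sticking_motion_at phi t].

End ImpactingHybridSystem.

Definition diverges (R : realType) (n : nat) (phi : R -> 'cV[R]_n) : Prop :=
  euclidean_norm (phi t) @[t --> +oo] --> +oo.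

(* Main.v *)
Require Import Defs.
From mathcomp Require Import all_boot all_order all_algebra.
From mathcomp Require Import all_classical all_reals all_analysis.
From mathcomp Require Import ring lra.
Set Implicit Arguments.
Unset Strict Implicit.
Unset Printing Implicit Defensive.

Import Order.TTheory GRing.Theory Num.Theory.
Import numFieldNormedType.Exports.
Local Open Scope classical_set_scope.
Local Open Scope ring_scope.

(** The linear functional [p x = e1^T A^-1 x] is a Lyapunov function. Since
  [p (A x + b mu) = x_1 - x^L_1], it decreases at rate at least [x^L_1 > 0] in
  [x_1 <= 0]. On [Gamma] the sticking field adds [- p c * a x / (e1^T A c)]
  to this rate; evaluated at the virtual pseudo-equilibrium, where the total rate
  is [0] and [a < 0], this gives [p c < 0]. Hence sticking ([a > 0]) makes [p]
  decrease even faster, and impacts, which add [v * p c] with [v > 0], make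
  it jump down. So [p] decreases at least linearly along every solution; only
  countably many times escape the derivative bound, and they do no harm since
  the jumps are downward. *)

(** Take for [tau] the supremum of the times in [a, b] where [g] is at most [lam]. As [g] has no
    upward jumps, [g tau > lam] would force [g > lam] just before [tau] too, against the choice of
    the supremum; right-continuity gives the opposite inequality. *)
Lemma last_crossing (R : realType) (g : R -> R) (a b lam : R) :
    a <= b -> g a < lam -> lam < g b ->
    (forall t, a <= t -> t < b -> g s @[s --> t^'+] --> g t) ->
    (forall t, a < t -> t <= b -> exists2 l, g s @[s --> t^'-] --> l & g t <= l) ->
  exists tau, [/\ a < tau, tau < b, g tau = lam &
    forall s, tau < s -> s <= b -> lam < g s].
Proof.
move=> ab ga gb rightc leftd.
pose S := [set t | [/\ a <= t, t <= b & g t <= lam]].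
have Sa : S a by split => //; exact: ltW.
have supS : has_sup S by split; [exists a | exists b => t []].
have a_tau : a <= sup S by apply: sup_upper_bound.
have tau_b : sup S <= b by apply: ge_sup => [|t []]; first by exists a.
have after s : sup S < s -> s <= b -> lam < g s.
  move=> ts sb; rewrite ltNge; apply/negP => gs.
  suff : s <= sup S by rewrite leNgt ts.
  apply: sup_upper_bound => //; split => //.
  exact: le_trans (ltW ts).
have g_le : g (sup S) <= lam.
  rewrite leNgt; apply/negP => g_gt.
  have a_lt : a < sup S.
    by rewrite lt_neqAle a_tau andbT; apply/eqP => e; move: g_gt; rewrite -e ltNge ltW.
  have [l gl lg] := leftd _ a_lt tau_b.
  have : \forall s \near (sup S)^'-, lam < g s.
    by apply: (cvgr_gt _ gl); exact: lt_le_trans lg.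
  rewrite near_withinE; move/nbhs_ballP => [e /= e0 Pe].
  have [t [at_ tb gt] et] := sup_adherent e0 supS.
  have tS : t <= sup S by apply: sup_upper_bound.
  have tneq : t < sup S.
    by rewrite lt_neqAle tS andbT; apply/eqP => tE; move: gt; rewrite tE leNgt g_gt.
  suff : lam < g t by rewrite ltNge gt.
  apply: Pe => //=.
  by rewrite /ball /= ger0_norm ?subr_ge0 //; lra.
have tau_lt : sup S < b.
  by rewrite lt_neqAle tau_b andbT; apply/eqP => e; move: g_le; rewrite e leNgt gb.
have g_eq : g (sup S) = lam.
  apply/eqP; rewrite eq_le g_le /=.
  apply: (cvgr_to_ge (rightc _ a_tau tau_lt)).
  near=> s; apply/ltW/after; near: s.
  - exact: nbhs_right_gt.
  - exact: nbhs_right_le.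
exists (sup S); split => //.
rewrite lt_neqAle a_tau andbT; apply/eqP => e.
by move: ga; rewrite {1}e g_eq ltxx.
Unshelve. all: by end_near. Qed.

Lemma derive_lt0_le_near (R : realType) (g : R -> R) (t b d : R) :
    t < b -> is_derive t 1 g d -> d < 0 -> exists s, [/\ t < s, s <= b & g s < g t].
Proof.
move=> tb [gd gE] d0.
have : h^-1 *: ((g \o shift t) (h *: 1) - g t) @[h --> 0^'] --> d.
  by rewrite -gE; exact: gd.
move/cvg_dnbhs_at_right => gcvg.
have tb0 : 0 < b - t by rewrite subr_gt0.
near (0 : R)^'+ => h.
have h0 : 0 < h by near: h; exact: nbhs_right_gt.
exists (h + t); split; first lra.
- have : h <= b - t by near: h; exact: nbhs_right_le.
  lra.
- have : h^-1 *: ((g \o shift t) (h *: 1) - g t) < 0.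
    by near: h; exact: cvgr_lt gcvg _ d0.
  by rewrite /= /GRing.scale /= mulr1 pmulr_rlt0 ?invr_gt0// subr_lt0.
Unshelve. all: by end_near. Qed.

(* Otherwise each level strictly between [g a] and [g b] is crossed upwards for
   a last time; such a time lies in [E], and different levels give different
   times, so that a countable set would be mapped onto an interval. *)
Lemma countable_derive_lt0_le (R : realType) (g : R -> R) (E : set R) (a b : R) :
    a <= b -> countable E ->
    (forall t, a <= t -> t < b -> g s @[s --> t^'+] --> g t) ->
    (forall t, a < t -> t <= b -> exists2 l, g s @[s --> t^'-] --> l & g t <= l) ->
    (forall t, a < t -> t < b -> ~ E t -> exists2 d, is_derive t 1 g d & d < 0) ->
  g b <= g a.
Proof.
move=> ab Ec rightc leftd dneg; rewrite leNgt; apply/negP => gab.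
have sub : `]g a, g b[%classic `<=` g @` E.
  move=> lam /=; rewrite in_itv/= => /andP[ga gb].
  have [tau [atau taub gtau after]] := last_crossing ab ga gb rightc leftd.
  exists tau => //; apply: contrapT => nE.
  (* A negative derivative at [tau] would bring [g] below [lam] at some later time, contradicting
     [after]. *)
  have [d gd d0] := dneg _ atau taub nE.
  have [s [ts sb]] := derive_lt0_le_near taub gd d0.
  by rewrite gtau ltNge ltW// after.
have : countable `]g a, g b[%classic.
  apply: sub_countable Ec; apply: card_le_trans (card_image_le g E).
  exact: subset_card_le.
move/countable_lebesgue_measure0; rewrite lebesgue_measure_itv /= lte_fin gab.
by rewrite -EFinB => -[] /eqP; rewrite subr_eq0 gt_eqF.
Qed.

Lemma scal_mul_continuous (R : realType) (n : nat) (r : 'rV[R]_n) :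
  continuous (fun x : 'cV[R]_n => scal (r *m x)).
Proof.
rewrite /scal; under eq_fun do rewrite mxE.
apply: continuous_big => [|j _ x]; first exact: add_continuous.
apply: (@cvgMl_tmp _ _ _ (nbhs_filter x)).
exact: (@coord_continuous R n 1 j ord0 x).
Qed.

Lemma is_derive_scal_mul (R : realType) (n : nat) (r : 'rV[R]_n.+1)
    (phi : R -> 'cV[R]_n.+1) (t : R) (dphi : 'cV[R]_n.+1) :
  is_derive t 1 phi dphi ->
  is_derive t 1 (fun s => scal (r *m phi s)) (scal (r *m dphi)).
Proof.
move=> [pd pE].
have cv : h^-1 *: ((phi \o shift t) (h *: 1) - phi t) @[h --> 0^'] --> dphi.
  by rewrite -pE; exact: pd.
have cvr : h^-1 *: (((fun s => scal (r *m phi s)) \o shift t) (h *: 1)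
    - scal (r *m phi t)) @[h --> 0^'] --> scal (r *m dphi).
  apply: cvg_trans (continuous_cvg _ (@scal_mul_continuous _ _ r dphi) cv).
  apply: near_eq_cvg; near=> h => /=.
  by rewrite /scal -scalemxAr mulmxBr !mxE.
split; first by apply/cvg_ex; eexists; exact: cvr.
exact: cvg_lim cvr.
Unshelve. all: by end_near. Qed.

Lemma scal_mul_le_euclidean_norm (R : realType) (n : nat) (r : 'rV[R]_n)
    (x : 'cV[R]_n) :
  `|scal (r *m x)| <= (\sum_j `|r ord0 j|) * euclidean_norm x.
Proof.
rewrite /scal mxE mulr_suml; apply: le_trans (ler_norm_sum _ _ _) _.
apply: ler_sum => j _; rewrite normrM ler_wpM2l//.
rewrite -sqrtr_sqr /euclidean_norm ler_sqrt; last first.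
  by apply: sumr_ge0 => i _; exact: sqr_ge0.
by rewrite (bigD1 j)//= lerDl; apply: sumr_ge0 => i _; exact: sqr_ge0.
Qed.

Section LyapunovFunctional.
Variables (R : realType) (n : nat).
Variables (A : 'M[R]_n.+1) (b c : 'cV[R]_n.+1) (mu : R).
Hypothesis detA : \det A != 0.

Let r : 'rV[R]_n.+1 := (e1 R n)^T *m invmx A.
Let k : R := comp1 (regular_equilibrium A b mu).

Lemma scal_e1 (x : 'cV[R]_n.+1) : scal ((e1 R n)^T *m x) = comp1 x.
Proof. by rewrite /scal /e1 trmx_delta -rowE mxE. Qed.

Lemma vfield_rate (x : 'cV[R]_n.+1) :
  scal (r *m vfield A b mu x) = comp1 x - k.
Proof.
rewrite /k /regular_equilibrium /vfield mulmxDr /r -!mulmxA mulKmx; last first.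
  by rewrite unitmxE unitfE.
by rewrite -mulmxDr scal_e1 /comp1 !mxE opprK.
Qed.

(** The correction term is a rank-one matrix: applied to the field it gives [c] times the
    acceleration, so [r] sees only the scalar [r *m c]. *)
Lemma sticking_vfield_rate (x : 'cV[R]_n.+1) :
  scal (r *m sticking_vfield A b c mu x) =
  comp1 x - k - (e1Ac A c)^-1 * scal (r *m c) * acceleration A b mu x.
Proof.
rewrite /sticking_vfield mulmxBl mul1mx mulmxBr -vfield_rate.
rewrite -scalemxAl -scalemxAr !mulmxA -[r *m c *m _ *m _ *m _]mulmxA.
rewrite -[r *m c *m _ *m _]mulmxA (mulmxA (e1 R n)^T).
rewrite [r *m c]mx11_scalar mul_scalar_mx /acceleration /scal !mxE.
by rewrite mulrA.
Qed.

End LyapunovFunctional.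

Theorem theorem5 (R : realType) (n : nat) (A : 'M[R]_n.+1) (b c : 'cV[R]_n.+1)
    (mu : R) (xSt : 'cV[R]_n.+1)
    (hc : comp1 c = 0)
    (hdet : \det A != 0)
    (hAc : e1Ac A c < -1)
    (hqc : scal (qT A *m c) != 0)
    (hxL : regular_equilibrium_virtual A b mu)
    (hxSt : pseudo_equilibrium A b c mu xSt)
    (hxStv : pseudo_equilibrium_virtual A b mu xSt) :
  forall (x0 : 'cV[R]_n.+1) (phi : R -> 'cV[R]_n.+1),
    is_solution A b c mu x0 phi -> diverges phi.
Proof.
move=> x0 phi [_ rightc leftd [E [Ec motion]]].
pose r := (e1 R n)^T *m invmx A.
pose k := comp1 (regular_equilibrium A b mu).
have k0 : 0 < k by [].
have Ac0 : (e1Ac A c)^-1 < 0 by rewrite invr_lt0; lra.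
have rc0 : scal (r *m c) < 0.
  have [S [[_ accS] SxSt]] := hxStv.
  have acc0 := accS _ SxSt.
  have [[xSt0 _] fSt] := hxSt.
  have := sticking_vfield_rate b c mu hdet xSt.
  rewrite fSt mulmx0 xSt0 -/r -/k {1}/scal mxE.
  set p := scal _; set a := acceleration _ _ _ _ in acc0 * => eq0.
  (* Here [eq0] says that this positive factor times [p] equals [- k], which is negative. *)
  have : 0 < (e1Ac A c)^-1 * a by rewrite nmulr_rgt0.
  move=> pos; rewrite -(pmulr_rlt0 _ pos).
  have -> : (e1Ac A c)^-1 * a * p = (e1Ac A c)^-1 * p * a by ring.
  lra.
(* The functional decreases at rate at least [k]; adding slope [k / 2] keeps the derivative strictly
   negative and still yields linear descent. *)
pose g t := scal (r *m phi t) + k / 2 * t.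
have lin_cvg (F : set_system R) (FF : Filter F) (t : R) :
    F --> t -> k / 2 * s @[s --> F] --> k / 2 * t.
  by move=> Ft; apply: cvgMl_tmp.
have g_le t : 0 <= t -> g t <= g 0.
  move=> t0; apply: (countable_derive_lt0_le t0 Ec).
  - move=> s s0 _; apply: cvgD.
      exact: continuous_cvg (@scal_mul_continuous _ _ r (phi s)) (rightc _ s0).
    by apply: lin_cvg; exact: cvg_at_right_filter.
  - move=> s s0 _; have [y [phiy [arr_in arr_out]]] := leftd _ s0.
    exists (scal (r *m y) + k / 2 * s).
      apply: cvgD; last by apply: lin_cvg; exact: cvg_at_left_filter.
      exact: continuous_cvg (@scal_mul_continuous _ _ r y) phiy.
    rewrite lerD2r.
    have [yin|yout] := pselect (Sigma_in A b mu y); last by rewrite arr_out.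
    rewrite arr_in// /reset mulmxDr -scalemxAr.
    have [_ v0] := yin.
    rewrite {1}/scal mxE [X in _ + X]mxE -!/(scal _) gerDl nmulr_lle0//.
    exact: ltW.
  - move=> s s0 _ nE.
    have [dphi [dd neg]] : exists dphi, is_derive s 1 phi dphi /\
        scal (r *m dphi) <= - k.
      have [/nbhs_singleton [neg dd]|[S [[SG acc] /nbhs_singleton [Ss dd]]]] :=
          motion _ s0 nE.
        exists (vfield A b mu (phi s)); split => //.
        by rewrite vfield_rate// -/k; lra.
      exists (sticking_vfield A b c mu (phi s)); split => //.
      have [phi0 _] := SG _ Ss.
      rewrite sticking_vfield_rate// phi0 -/r -/k sub0r lerBlDr lerDl.
      by rewrite mulr_ge0 ?ltW ?acc// nmulr_rgt0.
    exists (scal (r *m dphi) + k / 2); last lra.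
    apply: is_deriveD; first exact: is_derive_scal_mul.
    have := @is_deriveZ _ _ _ id (k / 2) s 1 1 (is_derive_id _ _).
    by rewrite /GRing.scale /= mulr1.
(* The summand 1 makes positivity of [K] immediate, so that one may cancel it below. *)
pose K := \sum_j `|r ord0 j| + 1.
have K0 : 0 < K by rewrite ltr_pwDr// sumr_ge0.
rewrite /diverges; apply/cvgryPge => M.
near=> t.
have t0 : 0 <= t by near: t; exact: nbhs_pinfty_ge.
(* From this time on, [g t <= g 0] gives [scal (r *m phi t) <= - (K * M)], while its absolute value
   is at most [K] times the norm. *)
have tbig : (K * M + g 0) / (k / 2) <= t.
  by near: t; apply: nbhs_pinfty_ge; exact: num_real.
have := g_le t t0.
move: tbig; rewrite ler_pdivrMr ?divr_gt0// => tbig gt.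
rewrite -(ler_pM2l K0).
have e0 : 0 <= euclidean_norm (phi t) by exact: sqrtr_ge0.
have le1 := scal_mul_le_euclidean_norm r (phi t).
have le2 : - scal (r *m phi t) <= `|scal (r *m phi t)| by rewrite -normrN ler_norm.
move: gt; rewrite {1}/g /K mulrDl mul1r.
move: tbig; rewrite /K.
lra.
Unshelve. all: by end_near. Qed.
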